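(* Let $(X,\le)$ be a finite poset, $K$ a field, and $\mathcal{J}=J(I(X,K))$ the Jacobson radical of the incidence algebra $I(X,K)$, with product $\cdot$. Assume that for all $(x,y,z),(u,v,w)\in X^3_<$ one has $$(x,z)\sim(u,w)\ \Longrightarrow\ (x,y,z)\approx(u,v,w).$$ Then all the totally compatible structures on $(\mathcal{J},\cdot)$ are proper.
   Context: All products are $K$-bilinear. The incidence algebra $I(X,K)$ is the associative $K$-algebra with basis $\{e_{xy}: x,y\in X,\ x\le y\}$ and multiplication $e_{xy}\cdot e_{uv}=\delta_{yu}e_{xv}$ ($\delta$ is the Kronecker delta). Its Jacobson radical is $\mathcal{J}=\mathrm{span}_K\{e_{xy}: x<y\}$. $X^n_<=\{(x_1,\dots,x_n)\in X^n: x_1<\dots<x_n\}$. A chain in $X$ is a nonempty subset of pairwise comparable elements. $\sim$ is the equivalence relation on $X^2_<$ generated by the pairs $((x,y),(u,v))\in X^2_<\times X^2_<$ such that there is a chain in $X$ containing $x,y,u,v$. $\approx$ is the equivalence relation on $X^3_<$ generated by the pairs $((x,y,z),(u,v,w))\in X^3_<\times X^3_<$ such that there is a chain in $X$ containing $x,y,z,u,v,w$. Two products $\cdot_1,\cdot_2$ on a vector space $V$ are totally compatible if $(a\cdot_1 b)\cdot_2 c=(a\cdot_2 b)\cdot_1 c=a\cdot_1(b\cdot_2 c)=a\cdot_2(b\cdot_1 c)$ for all $a,b,c\in V$. A totally compatible structure on an associative algebra $(A,\cdot)$ is an associative bilinear product $*$ on $A$ such that $\cdot$ and $*$ are totally compatible.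 The centroid $\Gamma(A)$ is the space of linear maps $\varphi:A\to A$ with $\varphi(a\cdot b)=a\cdot\varphi(b)=\varphi(a)\cdot b$ for all $a,b\in A$; for $\varphi\in\Gamma(A)$ let $a*_\varphi b=\varphi(a\cdot b)$. A bilinear product $\bullet$ on $A$ is annihilator-valued (with respect to $\cdot$) if $(A\cdot A)\bullet A=(A\bullet A)\cdot A=A\cdot(A\bullet A)=A\bullet(A\cdot A)=\{0\}$, where a product of subspaces is the span of all products of elements. An annihilator-valued structure on $(A,\cdot)$ is an associative annihilator-valued bilinear product on $A$. A totally compatible structure on $(A,\cdot)$ is proper if it is of the form $*_\varphi+\bullet$ with $\varphi\in\Gamma(A)$ and $\bullet$ an annihilator-valued structure on $(A,\cdot)$. *)

(* Defs.v *)
From HB Require Import structures.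
From Stdlib Require Import Relations.
From mathcomp Require Import all_boot all_order all_algebra.

Set Implicit Arguments.
Unset Strict Implicit.
Unset Printing Implicit Defensive.

Import Order.TTheory GRing.Theory.
Local Open Scope ring_scope.

Section Posets.
Context {d : Order.disp_t} {X : finPOrderType d}.

Definition is_chain (C : {set X}) : Prop :=
  C != set0 /\ {in C &, forall x y, (x >=< y)%O}.

Definition strict_tuple (n : nat) := {t : n.-tuple X | sorted <%O t}.

(* Equivalence relation on the strictly increasing n-tuples generated by the
   pairs of tuples whose entries lie in a common chain: for n = 2 it is the
   relation written ~, and for n = 3 the relation written as a double tilde. *)
Definition chain_equiv (n : nat) : relation (strict_tuple n) :=
  clos_refl_sym_trans (strict_tuple n)
    (fun s t => exists2 C : {set X},
       is_chain C & {subset (val s : seq X) ++ (val t : seq X) <= C}).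

Fact strict2_subproof (x y : X) : (x < y)%O -> sorted <%O [tuple x; y].
Proof. by move=> xy; rewrite /= xy. Qed.

Fact strict3_subproof (x y z : X) :
  (x < y)%O -> (y < z)%O -> sorted <%O [tuple x; y; z].
Proof. by move=> xy yz; rewrite /= xy yz. Qed.

Definition strict2 (x y : X) (xy : (x < y)%O) : strict_tuple 2 :=
  exist _ [tuple x; y] (strict2_subproof xy).

Definition strict3 (x y z : X) (xy : (x < y)%O) (yz : (y < z)%O) :
    strict_tuple 3 :=
  exist _ [tuple x; y; z] (strict3_subproof xy yz).

End Posets.

Section Products.
Variables (K : fieldType) (V : lmodType K).
Implicit Types (m s : V -> V -> V) (U W : V -> Prop).

Definition bilinear_product m : Prop := bilinear_for *:%R *:%R m.

Definition totally_compatible m s : Prop := forall a b c : V,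
  [/\ s (m a b) c = m (s a b) c,
      m (s a b) c = m a (s b c) &
      m a (s b c) = s a (m b c)].

Definition totally_compatible_structure m s : Prop :=
  [/\ bilinear_product s, associative s & totally_compatible m s].

Definition in_centroid m (phi : V -> V) : Prop :=
  linear phi /\
  forall a b : V, phi (m a b) = m a (phi b) /\ phi (m a b) = m (phi a) b.

Definition full_space : V -> Prop := fun=> True.

Definition product_space m U W : V -> Prop := fun v =>
  exists (n : nat) (c : 'I_n -> K) (u w : 'I_n -> V),
    [/\ forall i, U (u i), forall i, W (w i) &
        v = \sum_(i < n) c i *: m (u i) (w i)].

Definition is_zero_space U : Prop := forall v, U v <-> v = 0.

Definition annihilator_valued m s : Prop :=
  [/\ is_zero_space (product_space s (product_space m full_space full_space)
                                     full_space),
      is_zero_space (product_space m (product_space s full_space full_space)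
                                     full_space),
      is_zero_space (product_space m full_space
                                     (product_space s full_space full_space)) &
      is_zero_space (product_space s full_space
                                     (product_space m full_space full_space))].

Definition annihilator_valued_structure m s : Prop :=
  [/\ bilinear_product s, associative s & annihilator_valued m s].

Definition is_proper m s : Prop :=
  exists (phi : V -> V) (t : V -> V -> V),
    [/\ in_centroid m phi, annihilator_valued_structure m t &
        forall a b : V, s a b = phi (m a b) + t a b].

End Products.

Section JacobsonRadical.
Variable R : pzRingType.

Definition is_left_ideal (I : R -> Prop) : Prop :=
  [/\ I 0, forall a b, I a -> I b -> I (a + b) & forall r a, I a -> I (r * a)].

Definition is_maximal_left_ideal (M : R -> Prop) : Prop :=
  [/\ is_left_ideal M, ~ M 1 &
      forall I : R -> Prop, is_left_ideal I -> ~ I 1 ->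
        (forall a, M a -> I a) -> forall a, I a -> M a].

Definition jacobson_radical (a : R) : Prop :=
  forall M, is_maximal_left_ideal M -> M a.

End JacobsonRadical.

(* An element of I(X,K) is its family of coordinates in the basis e_xy,
   indexed by the pairs x <= y. A record keeps the convolution product apart
   from the pointwise product of finite functions. *)
Record incidence {d : Order.disp_t} (X : finPOrderType d) (K : fieldType) :=
  Incidence { coords : {ffun {p : X * X | (p.1 <= p.2)%O} -> K^o} }.
Arguments Incidence {d X K} coords.

Section IncidenceVector.
Context {d : Order.disp_t} {X : finPOrderType d} {K : fieldType}.
Local Notation I := (incidence X K).
Implicit Types f g h : I.

Fact coordsK : cancel (@coords d X K) Incidence. Proof. by case. Qed.

HB.instance Definition _ := [isNew for @coords d X K].
HB.instance Definition _ := [Choice of I by <:].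

Definition iadd f g : I := Incidence (coords f + coords g).
Definition iopp f : I := Incidence (- coords f).
Definition iscale (a : K) f : I := Incidence (a *: coords f).

Fact iaddA : associative iadd.
Proof. by move=> f g h; rewrite /iadd addrA. Qed.

Fact iaddC : commutative iadd.
Proof. by move=> f g; rewrite /iadd addrC. Qed.

Fact iadd0 : left_id (Incidence 0) iadd.
Proof. by case=> f; rewrite /iadd add0r. Qed.

Fact iaddN : left_inverse (Incidence 0) iopp iadd.
Proof. by move=> f; rewrite /iadd addNr. Qed.

HB.instance Definition _ := GRing.isZmodule.Build I iaddA iaddC iadd0 iaddN.

Fact iscaleA a b f : iscale a (iscale b f) = iscale (a * b) f.
Proof. by rewrite /iscale scalerA. Qed.

Fact iscale1 : left_id 1 iscale.
Proof. by case=> f; rewrite /iscale scale1r. Qed.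

Fact iscaleDr : right_distributive iscale +%R.
Proof. by move=> a f g; congr Incidence; rewrite scalerDr. Qed.

Fact iscaleDl f : {morph iscale^~ f : a b / a + b}.
Proof. by move=> a b; congr Incidence; rewrite scalerDl. Qed.

HB.instance Definition _ :=
  GRing.Zmodule_isLmodule.Build K I iscaleA iscale1 iscaleDr iscaleDl.

Fact incidence_vect_iso :
  Vector.axiom #|{: {p : X * X | (p.1 <= p.2)%O}}| I.
Proof.
exists (fun f => \row_i coords f (enum_val i)).
  by move=> a f g; apply/rowP => i; rewrite !mxE !ffunE.
pose r2v (r : 'rV[K]__) : I := Incidence [ffun p => r 0 (enum_rank p)].
exists r2v => [f|r].
  by apply: val_inj; apply/ffunP => p; rewrite ffunE mxE enum_rankK.
by apply/rowP => i; rewrite mxE ffunE enum_valK.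
Qed.

HB.instance Definition _ := Lmodule_hasFinDim.Build K I incidence_vect_iso.

End IncidenceVector.

Section Incidence.
Context {d : Order.disp_t} {X : finPOrderType d} {K : fieldType}.
Implicit Types (f g h : incidence X K) (x y z : X).

Definition coef f x y : K := oapp (coords f) 0 (insub (x, y)).

(* e_xy when x <= y, and 0 otherwise. *)
Definition e x y : incidence X K :=
  Incidence [ffun p : {p : X * X | (p.1 <= p.2)%O} => (val p == (x, y))%:R].

Definition imul f g : incidence X K :=
  Incidence [ffun p : {p : X * X | (p.1 <= p.2)%O} =>
    \sum_(y : X) coef f (val p).1 y * coef g y (val p).2].

Definition ione : incidence X K := \sum_(x : X) e x x.

Lemma coefP f g : (forall x y, coef f x y = coef g x y) -> f = g.
Proof.
move=> fg; apply: val_inj; apply/ffunP=> p; have := fg (val p).1 (val p).2.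
by rewrite /coef -surjective_pairing valK.
Qed.

Lemma coef_gt f x y : ~~ (x <= y)%O -> coef f x y = 0.
Proof. by move=> xy; rewrite /coef insubF //=; apply/negbTE. Qed.

Lemma coefD f g x y : coef (f + g) x y = coef f x y + coef g x y.
Proof. by rewrite /coef; case: insub => [p|] /=; rewrite ?ffunE ?addr0. Qed.

Lemma coefZ (a : K) f x y : coef (a *: f) x y = a * coef f x y.
Proof. by rewrite /coef; case: insub => [p|] /=; rewrite ?ffunE ?mulr0. Qed.

Lemma coef0 x y : coef 0 x y = 0.
Proof. by rewrite /coef; case: insub => [p|] /=; rewrite ?ffunE. Qed.

Lemma coef_sum (I : Type) (r : seq I) (P : pred I) (F : I -> incidence X K) x y :
  coef (\sum_(i <- r | P i) F i) x y = \sum_(i <- r | P i) coef (F i) x y.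
Proof.
by apply: (big_morph (fun f => coef f x y)) => [f g|]; rewrite ?coefD ?coef0.
Qed.

Lemma coef_e x y u v :
  coef (e x y) u v = ((u <= v)%O && (u == x) && (v == y))%:R.
Proof.
rewrite /coef; case: insubP => [p -> pE|/negbTE /= -> //].
by rewrite /= ffunE pE xpair_eqE.
Qed.

Lemma coef_imul f g x z :
  coef (imul f g) x z = \sum_(y : X) coef f x y * coef g y z.
Proof.
have [xz|xz] := boolP (x <= z)%O.
  by rewrite {1}/coef insubT /= ffunE.
rewrite coef_gt // big1 // => y _.
have [xy|xy] := boolP (x <= y)%O; last by rewrite coef_gt ?mul0r.
rewrite [coef g _ _]coef_gt ?mulr0 //.
by apply: contra xz; apply: le_trans.
Qed.

Lemma coef_ione x y : coef ione x y = (x == y)%:R.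
Proof.
rewrite coef_sum (bigD1 x) //= big1 ?addr0 => [|z /negPf zx].
  rewrite coef_e eqxx andbT eq_sym.
  by case: eqP => [->|]; rewrite ?lexx ?andbF.
by rewrite coef_e eq_sym zx andbF.
Qed.

Fact imulA : associative imul.
Proof.
move=> f g h; apply: coefP => x w; rewrite !coef_imul.
under eq_bigr do rewrite coef_imul mulr_sumr.
rewrite exchange_big /=; apply: eq_bigr => z _.
by rewrite coef_imul mulr_suml; apply: eq_bigr => y _; rewrite mulrA.
Qed.

Fact imul1l : left_id ione imul.
Proof.
move=> f; apply: coefP => x z; rewrite coef_imul (bigD1 x) //= big1.
  by rewrite coef_ione eqxx mul1r addr0.
by move=> y /negPf yx; rewrite coef_ione eq_sym yx mul0r.
Qed.

Fact imul1r : right_id ione imul.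
Proof.
move=> f; apply: coefP => x z; rewrite coef_imul (bigD1 z) //= big1.
  by rewrite coef_ione eqxx mulr1 addr0.
by move=> y /negPf yz; rewrite coef_ione yz mulr0.
Qed.

Fact imulDl : left_distributive imul +%R.
Proof.
move=> f g h; apply: coefP => x z; rewrite coefD !coef_imul -big_split /=.
by apply: eq_bigr => y _; rewrite coefD mulrDl.
Qed.

Fact imulDr : right_distributive imul +%R.
Proof.
move=> f g h; apply: coefP => x z; rewrite coefD !coef_imul -big_split /=.
by apply: eq_bigr => y _; rewrite coefD mulrDr.
Qed.

HB.instance Definition _ :=
  GRing.Zmodule_isPzRing.Build (incidence X K) imulA imul1l imul1r imulDl imulDr.

Lemma coefM f g x z : coef (f * g) x z = \sum_(y : X) coef f x y * coef g y z.
Proof. exact: coef_imul. Qed.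

Lemma coef1 x y : coef 1 x y = (x == y)%:R.
Proof. exact: coef_ione. Qed.

Lemma coefN f x y : coef (- f) x y = - coef f x y.
Proof. by apply/eqP; rewrite -addr_eq0 -coefD addNr coef0. Qed.

Lemma incidence_scaleAl (a : K) f g : a *: (f * g) = (a *: f) * g.
Proof.
apply: coefP => x z; rewrite coefZ !coefM mulr_sumr.
by apply: eq_bigr => y _; rewrite coefZ mulrA.
Qed.

Lemma incidence_scaleAr (a : K) f g : a *: (f * g) = f * (a *: g).
Proof.
apply: coefP => x z; rewrite coefZ !coefM mulr_sumr.
by apply: eq_bigr => y _; rewrite coefZ mulrCA.
Qed.

Lemma mul_e x y u v : (x <= y)%O -> (u <= v)%O ->
  e x y * e u v = (y == u)%:R *: e x v.
Proof.
move=> xy uv; apply: coefP => r t.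
rewrite coefM coefZ (bigD1 y) //= big1 ?addr0; last first.
  by move=> s /negPf sy; rewrite coef_e sy andbF mul0r.
rewrite !coef_e eqxx andbT.
have [yu|_] := eqVneq y u; last by rewrite andbF /= mulr0 mul0r.
rewrite -yu in uv.
rewrite mul1r -natrM mulnb andbT; congr (nat_of_bool _)%:R.
have [->|_] := eqVneq r x; last by rewrite !andbF.
have [->|_] := eqVneq t v; last by rewrite !andbF.
by rewrite ?eqxx xy uv (le_trans xy uv).
Qed.

Lemma incidence_decomp f :
  f = \sum_(p : X * X | (p.1 <= p.2)%O) coef f p.1 p.2 *: e p.1 p.2.
Proof.
apply: coefP => x z; rewrite coef_sum.
have [xz|xz] := boolP (x <= z)%O; last first.
  rewrite coef_gt // big1 // => p _.
  by rewrite coefZ coef_e (negbTE xz) mulr0.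
rewrite (bigD1 (x, z)) //= coefZ coef_e xz !eqxx mulr1 big1 ?addr0 //.
move=> [y t] /= /andP[_]; rewrite xpair_eqE coefZ coef_e -andbA.
rewrite [x == y]eq_sym [z == t]eq_sym => /negbTE->.
by rewrite andbF mulr0.
Qed.

Definition radical : {vspace incidence X K} :=
  <<[seq e p.1 p.2 | p in [pred p : X * X | (p.1 < p.2)%O]]>>%VS.

Lemma radicalP f : reflect (forall x, coef f x x = 0) (f \in radical).
Proof.
apply: (iffP idP) => [fJ x|f0].
  rewrite (coord_span (fJ : f \in span (in_tuple _))) coef_sum big1 // => i _.
  rewrite coefZ; set g := _`_i.
  have /mapP[p] : g \in [seq e p.1 p.2 | p in [pred p : X * X | (p.1 < p.2)%O]].
    exact: mem_nth.
  rewrite mem_enum inE => p12 ->; rewrite coef_e lexx /=.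
  by case: eqP => [->|]; rewrite ?(lt_eqF p12) mulr0.
rewrite [f]incidence_decomp; apply: memv_suml => p p12.
have [p1p2|np12] := eqVneq p.1 p.2; first by rewrite -p1p2 f0 scale0r mem0v.
apply/memvZ/memv_span/mapP; exists p => //.
by rewrite mem_enum inE lt_neqAle np12.
Qed.

Lemma coefM_diag f g x : coef (f * g) x x = coef f x x * coef g x x.
Proof.
rewrite coefM (bigD1 x) //= big1 ?addr0 // => y yx.
have [xy|xy] := boolP (x <= y)%O; last by rewrite coef_gt ?mul0r.
rewrite [coef g _ _]coef_gt ?mulr0 //.
by apply: contra yx => yx; rewrite eq_le xy yx.
Qed.

Lemma radical_mulr f g : g \in radical -> f * g \in radical.
Proof.
by move=> /radicalP g0; apply/radicalP => x; rewrite coefM_diag g0 mulr0.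
Qed.

Lemma radical_nilpotent f : f \in radical -> f ^+ #|X| = 0.
Proof.
move=> /radicalP f0; pose ht z := #|[pred y : X | (y < z)%O]|.
have ht_lt x y : (x < y)%O -> (ht x < ht y)%N.
  move=> xy; apply/proper_card/properP; split.
    by apply/subsetP => z; rewrite !inE => zx; apply: lt_trans xy.
  by exists x; rewrite !inE ?xy ?ltxx.
have htX z : (ht z < #|X|)%N.
  apply/proper_card/properP; split; first exact/subsetP.
  by exists z; rewrite !inE ?ltxx.
have fn n x z : (ht z < ht x + n)%N -> coef (f ^+ n) x z = 0.
  elim: n x => [|n IHn] x htn.
    rewrite expr0 coef1; case: eqP htn => // ->.
    by rewrite addn0 ltnn.
  rewrite exprS coefM big1 // => y _.
  have [xy|nxy] := boolP (x < y)%O.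
    rewrite IHn ?mulr0 //; apply: leq_trans htn _.
    by rewrite addnS -addSn leq_add2r; apply: ht_lt.
  have [<-|nexy] := eqVneq x y; first by rewrite f0 mul0r.
  by rewrite coef_gt ?mul0r //; apply: contra nxy => xy; rewrite lt_neqAle nexy.
apply: coefP => x z; rewrite fn ?coef0 //.
exact: leq_trans (htX z) (leq_addl _ _).
Qed.

Theorem radical_jacobson f : f \in radical <-> jacobson_radical f.
Proof.
split=> [fJ M [[M0 MD MM] nM1 Mmax]|Jf].
  pose I g := exists2 m, M m & exists r, g = m + r * f.
  apply: (Mmax I); last 1 first.
  - by exists 0 => //; exists 1; rewrite mul1r add0r.
  - split=> [|_ _ [m Mm [r ->]] [m' Mm' [r' ->]]|s _ [m Mm [r ->]]].
    + by exists 0 => //; exists 0; rewrite mul0r addr0.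
    + by exists (m + m'); [exact: MD | exists (r + r'); rewrite mulrDl addrACA].
    + by exists (s * m); [exact: MM | exists (s * r); rewrite mulrDr mulrA].
  - case=> m Mm [r /eqP]; rewrite -subr_eq => /eqP mE.
    apply: nM1; have := subrX1 (r * f) #|X|.
    rewrite radical_nilpotent ?radical_mulr // sub0r.
    move=> /(congr1 -%R); rewrite opprK -mulNr opprB mE => mV.
    have mS : GRing.comm m (\sum_(i < #|X|) (r * f) ^+ i).
      rewrite /GRing.comm mulr_sumr mulr_suml.
      apply: eq_bigr => i _; apply/commrX.
      by rewrite -mE /GRing.comm mulrBl mulrBr mul1r mulr1.
    by rewrite mV mS; apply: MM Mm.
  - by move=> g Mg; exists g => //; exists 0; rewrite mul0r addr0.
apply/radicalP => x; apply: (Jf (fun g => coef g x x = 0)); split.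
- split=> [|g h g0 h0|r g g0]; first exact: coef0.
    by rewrite coefD g0 h0 addr0.
  by rewrite coefM_diag g0 mulr0.
- by rewrite coef1 eqxx => /eqP; rewrite oner_eq0.
move=> I [I0 ID IM] nI1 MI g Ig; apply/eqP/negPn/negP => g0; apply: nI1.
pose c : incidence X K := (coef g x x)^-1 *: (1 : incidence X K).
have -> : 1 = (1 - c * g) + c * g by rewrite subrK.
apply: ID; last exact: IM.
apply: MI; rewrite coefD coefN coefM_diag coefZ !coef1 eqxx mulr1.
by rewrite mulVf // subrr.
Qed.

(* The type of elements of the Jacobson radical, with the product inherited
   from I(X,K). *)
Definition radical_mul (a b : subvs_of radical) : subvs_of radical :=
  Subvs (radical_mulr (vsval a) (valP b)).

Lemma radical_mulA : associative radical_mul.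
Proof. by move=> a b c; apply: val_inj; exact: mulrA. Qed.

Lemma radical_mul_bilinear : bilinear_product radical_mul.
Proof.
split=> c k a b; apply: val_inj => /=.
  by rewrite mulrDl -incidence_scaleAl.
by rewrite mulrDr -incidence_scaleAr.
Qed.

End Incidence.

Arguments radical {d} X K.

(* Main.v *)
(* For x < y < z < w, the four products of e_xy, e_yz and e_zw that mix . and *
   agree by total compatibility, and are a multiple of e_xw. Hence the coefficient
   c(x,y,z) of e_xz in e_xy * e_yz takes the same value on all the triples of a
   4-chain, and so it is constant on the classes of the equivalence relation on
   triples. By hypothesis c then factors through the classes of pairs (x,z), and
   scaling e_xz by the resulting value is an element phi of the centroid with
   (a * b) . c = phi (a . b . c). This identity alone makes the remainder
   a * b - phi (a . b) associative and annihilator-valued. *)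
From HB Require Import structures.
From Stdlib Require Import Relations.
From mathcomp Require Import all_boot all_order all_algebra.
Require Import Defs.
Import Order.TTheory.
Import GRing.Theory.

Set Implicit Arguments.
Unset Strict Implicit.
Unset Printing Implicit Defensive.

Local Open Scope ring_scope.

(** * Chains, the two equivalence relations, and functions constant on triples of 4-chains *)

Section Chains.
Context {d : Order.disp_t} {X : finPOrderType d}.
Implicit Types (x y z : X) (p q : X * X).

(** A boolean form of the generating relation on strict pairs, so that [connect] decides membership
    in a class on the finite type [X * X]. *)
Definition chain_pair p q : bool :=
  [&& (p.1 < p.2)%O, (q.1 < q.2)%O
    & all2rel >=<%O [:: p.1; p.2; q.1; q.2]].

Lemma chain_pair_sym : symmetric chain_pair.
Proof.
move=> [x y] [u v]; rewrite /chain_pair /= andbCA; congr [&& _, _ & _].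
by apply: eq_allrel_mem2 => z; rewrite !inE; do 4![case: (z == _)].
Qed.

(** Induction on the path: the four entries of each edge are pairwise comparable, so they form the
    chain that a generating step asks for. *)
Lemma connect_chain_equiv p q (hp : (p.1 < p.2)%O) (hq : (q.1 < q.2)%O) :
  connect chain_pair p q -> chain_equiv (strict2 hp) (strict2 hq).
Proof.
case/connectP=> s; elim: s p hp => [|r s IHs] p hp /=.
  move=> _ pq; subst q.
  by rewrite (bool_irrelevance hp hq); apply: rst_refl.
case/andP=> /and3P[_ hr /allrelP pr] /IHs{}IHs /(IHs hr).
apply: rst_trans; apply: rst_step.
exists [set z in [:: p.1; p.2; r.1; r.2]].
  split=> [|x y]; last by rewrite !inE => *; apply: pr; rewrite !inE.
  by apply/set0Pn; exists p.1; rewrite !inE eqxx.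
by move=> x; rewrite /= !inE.
Qed.

Section Triples.
Variables (T : Type) (c : X -> X -> X -> T).
Hypothesis c4 : forall x y z w, (x < y)%O -> (y < z)%O -> (z < w)%O ->
  [/\ c x y w = c x y z, c x z w = c x y z & c y z w = c x y z].

Lemma const_triple_top x y z w :
  (x < y)%O -> (y < z)%O -> (z <= w)%O -> c x y w = c x y z.
Proof.
move=> xy yz; rewrite le_eqVlt => /predU1P[<- //|zw].
by have [] := c4 xy yz zw.
Qed.

Lemma const_triple_bot u x y z :
  (u <= x)%O -> (x < y)%O -> (y < z)%O -> c u y z = c x y z.
Proof.
rewrite le_eqVlt => /predU1P[-> //|ux] xy yz.
by have [_ -> ->] := c4 ux xy yz.
Qed.

Lemma const_triple_mid x y v z : (x < y)%O -> (y < z)%O -> (x < v)%O ->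
  (v < z)%O -> (y >=< v)%O -> c x y z = c x v z.
Proof.
move=> xy yz xv vz /comparable_ltgtP[yv|vy|-> //].
  by have [-> ->] := c4 xy yv vz.
by have [-> ->] := c4 xv vy yz.
Qed.

(** The larger of the two top entries and the smaller of the two bottom entries can serve both
    triples without changing [c]. The triples then differ only in the middle, where the entries are
    comparable. *)
Lemma const_triple_chain x y z u v w : (x < y)%O -> (y < z)%O ->
    (u < v)%O -> (v < w)%O -> (x >=< u)%O -> (y >=< v)%O -> (z >=< w)%O ->
  c x y z = c u v w.
Proof.
move=> xy yz uv vw xu yv zw.
wlog zlew : x y z u v w xy yz uv vw xu yv zw / (z <= w)%O => [hwlog|].
  case/orP: (zw) => [le|le]; first exact: hwlog.
  by apply/esym; apply: hwlog; rewrite // comparable_sym.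
have yw := lt_le_trans yz zlew.
rewrite -(const_triple_top xy yz zlew).
case/orP: xu => [xleu|ulex].
  rewrite -(const_triple_bot xleu uv vw).
  by apply: const_triple_mid; rewrite // (le_lt_trans xleu).
rewrite -(const_triple_bot ulex xy yw).
by apply: const_triple_mid; rewrite // (le_lt_trans ulex).
Qed.

Lemma chain_equiv_const x y z u v w (xy : (x < y)%O) (yz : (y < z)%O)
    (uv : (u < v)%O) (vw : (v < w)%O) :
  chain_equiv (strict3 xy yz) (strict3 uv vw) -> c x y z = c u v w.
Proof.
pose ct (t : strict_tuple (X := X) 3) :=
  c (tnth (val t) 0) (tnth (val t) 1) (tnth (val t) 2%:R).
suff cE s t : chain_equiv s t -> ct s = ct t by move/cE.
(* Only a generating step has content; there the chain makes entries in equal positions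
   comparable. *)
elim=> {s t} [s t [C [_ Cc] sC]|//|s t _ ->|s t r _ -> _ ->] //.
have sP i : tnth (val s) i \in C by apply: sC; rewrite mem_cat mem_tnth.
have tP i : tnth (val t) i \in C by apply: sC; rewrite mem_cat mem_tnth orbT.
have lt3 (r : strict_tuple (X := X) 3) :
    (tnth (val r) 0 < tnth (val r) 1)%O /\
    (tnth (val r) 1 < tnth (val r) 2%:R)%O.
  case: r => [[[|r0 [|r1 [|r2 [|]]]] //= h] hs].
  by rewrite !(tnth_nth r0) /=; case/and3P: (hs).
have [s01 s12] := lt3 s; have [t01 t12] := lt3 t.
by apply: const_triple_chain => //; apply: Cc.
Qed.

End Triples.
End Chains.

(** * Descent of a function of triples to the classes of pairs *)

Section ClassFunction.
Context {d : Order.disp_t} {X : finPOrderType d}.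
Variables (T : Type) (c0 : T) (c : X -> X -> X -> T).

(** The value of [c] on some triple whose outer pair lies in the class of [p]; [c0] is the value on
    classes that contain no such outer pair. *)
Definition class_value (p : X * X) : T :=
  if [pick t : X * X * X | [&& (t.1.1 < t.1.2)%O, (t.1.2 < t.2)%O
                             & connect chain_pair p (t.1.1, t.2)]] is Some t
  then c t.1.1 t.1.2 t.2 else c0.

(** Connected pairs give [pick] the same predicate, hence the same triple, so this holds for an
    arbitrary [c]. *)
Lemma class_value_chain p q : chain_pair p q -> class_value p = class_value q.
Proof.
move=> pq; rewrite /class_value; congr (if _ is Some t then _ else _).
apply: eq_pick => t /=; do 2![congr (_ && _)].
exact: same_connect (sym_connect_sym chain_pair_sym) _ _ (connect1 pq) _.
Qed.

Lemma class_value_sub x y z : (x < y)%O -> (y < z)%O ->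
  class_value (x, y) = class_value (x, z) /\
  class_value (y, z) = class_value (x, z).
Proof.
move=> xy yz; have xz := lt_trans xy yz.
have cmp (a b : X) : (a < b)%O -> (a >=< b)%O * (b >=< a)%O.
  by move=> ab; rewrite /Order.comparable (ltW ab) orbT.
by split; apply: class_value_chain;
  rewrite /chain_pair /= xz ?xy ?yz /allrel /= !comparablexx
          ?(cmp _ _ xy) ?(cmp _ _ yz) ?(cmp _ _ xz).
Qed.

(** The picked triple has its outer pair in the class of [(x, z)]. By [hX] it is then equivalent to
    [(x, y, z)] as a triple, where [c] is constant. *)
Lemma class_valueE
    (hX : forall (x y z u v w : X) (xy : (x < y)%O) (yz : (y < z)%O)
                 (uv : (u < v)%O) (vw : (v < w)%O),
       chain_equiv (strict2 (lt_trans xy yz)) (strict2 (lt_trans uv vw)) ->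
       chain_equiv (strict3 xy yz) (strict3 uv vw))
    (c4 : forall x y z w, (x < y)%O -> (y < z)%O -> (z < w)%O ->
       [/\ c x y w = c x y z, c x z w = c x y z & c y z w = c x y z]) x y z :
  (x < y)%O -> (y < z)%O -> class_value (x, z) = c x y z.
Proof.
move=> xy yz; rewrite /class_value; case: pickP => [[[u v] w] /= |noT].
  case/and3P=> uv vw xzuw; apply/esym/(chain_equiv_const c4 (xy := xy) (yz := yz)).
  apply: hX.
  exact: (@connect_chain_equiv _ _ (x, z) (u, w)).
by have := noT (x, y, z); rewrite /= xy yz connect0.
Qed.

End ClassFunction.

(** * The basis of the radical and the maps that are diagonal in it *)

Section RadicalBasis.
Context {d : Order.disp_t} {X : finPOrderType d} {K : fieldType}.
Local Notation J := (subvs_of (radical X K)).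
Implicit Types (x y z : X) (f g : incidence X K) (a b : J).

Lemma coefM_er f v w x z : (v <= w)%O ->
  coef (f * e v w) x z = (z == w)%:R * coef f x v.
Proof.
move=> vw; rewrite coefM (bigD1 v) //= big1 ?addr0 => [|y /negPf yv].
  by rewrite coef_e eqxx andbT mulrC; case: eqP => [->|]; rewrite ?vw ?andbF.
by rewrite coef_e yv andbF mulr0.
Qed.

Lemma coefM_el g u v x z : (u <= v)%O ->
  coef (e u v * g) x z = (x == u)%:R * coef g v z.
Proof.
move=> uv; rewrite coefM (bigD1 v) //= big1 ?addr0 => [|y /negPf yv].
  by rewrite coef_e eqxx andbT; case: eqP => [->|]; rewrite ?uv ?andbF.
by rewrite coef_e yv andbF mul0r.
Qed.

Lemma coef_radical f x y : f \in radical X K -> ~~ (x < y)%O -> coef f x y = 0.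
Proof.
move=> /radicalP f0; have [<-|nxy] := eqVneq x y; first by rewrite f0.
by rewrite lt_neqAle nxy /=; apply: coef_gt.
Qed.

Definition rad_e x y : J := vsproj (radical X K) (e x y).

Lemma val_rad_e x y : (x < y)%O -> vsval (rad_e x y) = e x y.
Proof.
move=> xy; apply: vsprojK; apply/radicalP => z; rewrite coef_e lexx /=.
by case: eqP => // ->; rewrite (lt_eqF xy).
Qed.

Lemma radical_mul_e x y u v : (x < y)%O -> (u < v)%O ->
  radical_mul (rad_e x y) (rad_e u v) = (y == u)%:R *: rad_e x v.
Proof.
move=> xy uv; apply: val_inj.
rewrite /= (val_rad_e xy) (val_rad_e uv) mul_e ?ltW //.
have [yu|_] := eqVneq y u; last by rewrite !scale0r.
by rewrite !scale1r val_rad_e // (lt_trans xy) ?yu.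
Qed.

Lemma rad_e_decomp a :
  a = \sum_(p : X * X | (p.1 < p.2)%O) coef (vsval a) p.1 p.2 *: rad_e p.1 p.2.
Proof.
apply: val_inj; rewrite /= raddf_sum /= {1}[vsval a]incidence_decomp.
rewrite (bigID (fun p : X * X => p.1 < p.2)%O) /=.
rewrite [X in _ + X]big1 ?addr0 => [|p /andP[_ np]]; last first.
  by rewrite coef_radical ?scale0r ?subvsP.
apply: eq_big => p; first by rewrite andbC; apply: andb_idr => /ltW.
by case/andP=> _ pp; rewrite val_rad_e.
Qed.

Lemma linear_ext (V : lmodType K) (F G : J -> V) : linear F -> linear G ->
  (forall x y, (x < y)%O -> F (rad_e x y) = G (rad_e x y)) -> F =1 G.
Proof.
move=> linF linG FG a.
pose mF := GRing.isLinear.Build K J V *:%R F linF.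
pose mG := GRing.isLinear.Build K J V *:%R G linG.
pose lF : {linear J -> V} := HB.pack F mF.
pose lG : {linear J -> V} := HB.pack G mG.
rewrite [a]rad_e_decomp -[F]/(lF : _ -> _) -[G]/(lG : _ -> _) !linear_sum.
by apply: eq_bigr => p pp; rewrite !linearZ /= FG.
Qed.

Section ScaleCoefs.
Variable g : X * X -> K.

Definition scale_coefs f : incidence X K :=
  Incidence [ffun p => g (val p) * coords f p].

Lemma coef_scale_coefs f x y : coef (scale_coefs f) x y = g (x, y) * coef f x y.
Proof.
rewrite /coef; case: insubP => [p _ pE|_] /=; last by rewrite mulr0.
by rewrite ffunE pE.
Qed.

Lemma scale_coefs_radical a : scale_coefs (vsval a) \in radical X K.
Proof.
apply/radicalP => x; rewrite coef_scale_coefs.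
by have /radicalP-> := subvsP a; rewrite mulr0.
Qed.

Definition radical_scale a : J := Subvs (scale_coefs_radical a).

Lemma radical_scale_linear : linear radical_scale.
Proof.
move=> k a b; apply: val_inj; apply: coefP => x y /=.
by rewrite coefD coefZ !coef_scale_coefs coefD coefZ mulrDr mulrCA.
Qed.

Lemma radical_scale_e x y : (x < y)%O ->
  radical_scale (rad_e x y) = g (x, y) *: rad_e x y.
Proof.
move=> xy; apply: val_inj; apply: coefP => u v.
rewrite /= coefZ coef_scale_coefs val_rad_e // coef_e -andbA.
by do 2![case: eqP => [->|_]; rewrite ?andbF ?mulr0 //].
Qed.

(** In the coefficient at [(x, z)] of a product, only the summands with [x < y < z] survive, and for
    these the three scalars [g (x, y)], [g (y, z)] and [g (x, z)] coincide. *)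
Lemma radical_scale_centroid
    (gP : forall x y z, (x < y)%O -> (y < z)%O ->
       g (x, y) = g (x, z) /\ g (y, z) = g (x, z)) :
  in_centroid (@radical_mul d X K) radical_scale.
Proof.
split=> [|a b]; first exact: radical_scale_linear.
split; apply: val_inj; apply: coefP => x z;
  rewrite /= coef_scale_coefs !coefM mulr_sumr; apply: eq_bigr => y _;
  rewrite coef_scale_coefs;
  (have [xy|nxy] := boolP (x < y)%O;
     last by rewrite [coef (vsval a) x y]coef_radical ?subvsP // ?(mul0r, mulr0));
  (have [yz|nyz] := boolP (y < z)%O;
     last by rewrite [coef (vsval b) y z]coef_radical ?subvsP // !mulr0);
  have [gxy gyz] := gP _ _ _ xy yz.
  by rewrite gyz mulrCA.
by rewrite gxy mulrA.
Qed.

End ScaleCoefs.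
End RadicalBasis.

(** * Properness derived from an element of the centroid, for any associative algebra *)

Section Products.
Variables (K : fieldType) (V : lmodType K).
Implicit Types (m s : V -> V -> V).

Lemma bilinear_product_lin m : bilinear_product m ->
  (forall b, linear (m^~ b)) /\ (forall a, linear (m a)).
Proof. by move=> [ml mr]; split=> u k a b; rewrite ?ml ?mr. Qed.

Lemma linear_fun0 (f : V -> V) : linear f -> f 0 = 0.
Proof. by move=> /(_ (-1) 0 0); rewrite scaler0 addr0 scaleN1r addNr. Qed.

Lemma linear_span0 (f : V -> V) m (U W : V -> Prop) : linear f ->
  (forall u w, U u -> W w -> f (m u w) = 0) ->
  forall v, product_space m U W v -> f v = 0.
Proof.
move=> linf f0 v [n [k [u [w [Uu Ww ->]]]]].
elim/big_rec: _ => [|i x _ fx]; first exact: linear_fun0.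
by rewrite linf f0 // scaler0 add0r.
Qed.

Lemma product_space_eq0 m (U W : V -> Prop) :
  (forall u w, U u -> W w -> m u w = 0) -> is_zero_space (product_space m U W).
Proof.
move=> m0 v; split=> [|->]; first by apply: (linear_span0 (f := id)).
exists 0, (fun=> 0), (fun=> 0), (fun=> 0).
by rewrite big_ord0; split=> // -[].
Qed.

(* By total compatibility, each of the four vanishing conditions on the
   remainder amounts to the last hypothesis. *)
Lemma proper_of_centroid m s phi :
    bilinear_product m -> associative m -> totally_compatible_structure m s ->
    in_centroid m phi ->
    (forall a b c, m (s a b) c = phi (m (m a b) c)) ->
  is_proper m s.
Proof.
move=> /bilinear_product_lin[ml mr] mA [/bilinear_product_lin[sl sr] sA tc].
move=> [linp phiP] smE; pose t a b := s a b - phi (m a b).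
have tl b : linear (t^~ b).
  by move=> k a a'; rewrite /t sl ml linp opprD addrACA scalerBr.
have tr a : linear (t a).
  by move=> k b b'; rewrite /t sr mr linp opprD addrACA scalerBr.
have linB (f : V -> V) : linear f -> {morph f : x y / x - y}.
  by move=> linf x y; rewrite addrC -scaleN1r linf scaleN1r addrC.
have tm a b c : m (t a b) c = 0.
  by rewrite (linB (m^~ c)) // smE -(phiP (m a b) c).2 subrr.
have mt a b c : m a (t b c) = 0.
  rewrite linB //; have [_ <- _] := tc a b c.
  by rewrite smE -mA (phiP a (m b c)).1 subrr.
have tml a b c : t (m a b) c = 0.
  by rewrite /t; have [-> _ _] := tc a b c; rewrite smE subrr.
have tmr a b c : t a (m b c) = 0.
  by rewrite /t; have [_ h <-] := tc a b c; rewrite -h smE mA subrr.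
exists phi, t; split=> [||a b]; last by rewrite addrC subrK.
  by split.
split.
- by split=> u k a b; [exact: tl | exact: tr].
(* Values of [t] are annihilated by [m] on both sides, so the outer [t] in each iterated product can
   be replaced by [s]. *)
- move=> a b c.
  have -> : t a (t b c) = s a (t b c).
    by rewrite {1}/t mt linear_fun0 // subr0.
  have -> : t (t a b) c = s (t a b) c.
    by rewrite {1}/t tm linear_fun0 // subr0.
  (* By associativity of [s] it remains to compare [s a (phi (m b c))] with [s (phi (m a b)) c].
     Moving [phi] onto an outer factor and then out again turns them into [phi (m (s a b) c)] and
     [phi (m a (s b c))]. *)
  rewrite (linB (s a)) // (linB (s^~ c)) // sA; congr (_ - _).
  rewrite (phiP b c).1 (phiP a b).2.
  have [_ h1 h2] := tc a b (phi c); rewrite -h2 -h1.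
  have [h3 h4 _] := tc (phi a) b c; rewrite h3 h4.
  rewrite -(phiP (s a b) c).1 -(phiP a (s b c)).2.
  by have [_ <- _] := tc a b c.
- have span0 (f : V -> V) m' : linear f -> (forall a b, f (m' a b) = 0) ->
      forall v, product_space m' (@full_space K V) (@full_space K V) v -> f v = 0.
    by move=> linf f0; apply: linear_span0 => // a b _ _; apply: f0.
  split; apply: product_space_eq0 => u w.
  + by move=> + _; apply: (span0 (t^~ w) m).
  + by move=> + _; apply: (span0 (m^~ w) t).
  + by move=> _; apply: (span0 (m u) t).
  + by move=> _; apply: (span0 (t u) m).
Qed.

End Products.

(** * Structure constants of a totally compatible product on the radical *)

Section StructureConstants.
Context {d : Order.disp_t} {X : finPOrderType d} {K : fieldType}.
Local Notation J := (subvs_of (radical X K)).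
Variable star : J -> J -> J.
Hypothesis tcs : totally_compatible_structure (@radical_mul d X K) star.

Definition star_coef (x y z : X) : K :=
  coef (vsval (star (rad_e x y) (rad_e y z))) x z.

(** The product of [rad_e x y] and [rad_e y z] under [star] may have other coefficients. Multiplying
    by [rad_e z w] on the right leaves only column [w], and total compatibility leaves only row
    [x]. *)
Lemma star_mul_e x y z w : (x < y)%O -> (y < z)%O -> (z < w)%O ->
  radical_mul (star (rad_e x y) (rad_e y z)) (rad_e z w) =
  star_coef x y z *: rad_e x w.
Proof.
move=> xy yz zw; have xw := lt_trans (lt_trans xy yz) zw.
apply: val_inj; apply: coefP => r t.
rewrite /= coefZ (val_rad_e zw) (val_rad_e xw) coefM_er ?ltW //.
rewrite coef_e -andbA.
have [->|rx] := eqVneq r x.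
  by case: eqP => [->|_]; rewrite ?xw ?(ltW xw) ?andbF /= ?mul0r ?mulr0 ?mul1r ?mulr1.
(* Off row [x], the product is rewritten with [e x y] as its left factor under the ordinary product,
   which makes the coefficient vanish. *)
rewrite andbF mulr0 -coefM_er ?ltW // -(val_rad_e zw).
have [_ _ tc] := tcs; have [_ h _] := tc (rad_e x y) (rad_e y z) (rad_e z w).
move/(congr1 vsval): h => /= ->.
by rewrite val_rad_e // coefM_el ?ltW // (negPf rx) mul0r.
Qed.

(** Each of the other three mixed products of [rad_e x y], [rad_e y z] and [rad_e z w] has one of
    the listed constants as its coefficient at [(x, w)]. *)
Lemma star_coef_chain4 x y z w : (x < y)%O -> (y < z)%O -> (z < w)%O ->
  [/\ star_coef x y w = star_coef x y z, star_coef x z w = star_coef x y z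
    & star_coef y z w = star_coef x y z].
Proof.
move=> xy yz zw; have xw := lt_trans (lt_trans xy yz) zw.
have E := star_mul_e xy yz zw.
have coefE a : coef (vsval (a *: rad_e x w : J)) x w = a.
  by rewrite /= coefZ val_rad_e // coef_e !eqxx (ltW xw) mulr1.
have [_ _ tc] := tcs; have [h1 h2 h3] := tc (rad_e x y) (rad_e y z) (rad_e z w).
have mulE u v t : (u < v)%O -> (v < t)%O ->
    radical_mul (rad_e u v) (rad_e v t) = rad_e u t :> J.
  by move=> uv vt; rewrite radical_mul_e // eqxx scale1r.
split.
- by rewrite /star_coef -[rad_e y w](mulE y z) // -h3 -h2 E coefE.
- by rewrite /star_coef -[rad_e x z](mulE x y) // h1 E coefE.
- move: h2; rewrite E => /(congr1 (fun a : J => coef (vsval a) x w)).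
  by rewrite coefE /= val_rad_e // coefM_el ?ltW // eqxx mul1r.
Qed.

(** Both sides are trilinear, so basis elements suffice. *)
Lemma star_mul_centroid (g : X * X -> K) :
    (forall x y z w, (x < y)%O -> (y < z)%O -> (z < w)%O ->
       g (x, w) = star_coef x y z) ->
  forall a b c, radical_mul (star a b) c =
                radical_scale g (radical_mul (radical_mul a b) c).
Proof.
move=> gE; have [/bilinear_product_lin[sl sr] _ tc] := tcs.
have [ml mr] := bilinear_product_lin (@radical_mul_bilinear d X K).
have linp := radical_scale_linear g.
move=> a b c; move: a.
apply: linear_ext => [k ? ?|k ? ?|x y xy]; rewrite ?sl ?ml ?linp //.
move: b; apply: linear_ext => [k ? ?|k ? ?|u v uv].
- by rewrite sr ml.
- by rewrite mr ml linp.
move: c; apply: linear_ext => [k ? ?|k ? ?|r t rt].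
- by rewrite mr.
- by rewrite mr linp.
have [h1 h2 h3] := tc (rad_e x y) (rad_e u v) (rad_e r t).
(* If two neighbouring basis elements do not compose, total compatibility lets the ordinary product
   act on that pair first, and both sides are zero. *)
have [yu|yu] := eqVneq y u; last first.
  rewrite -h1 radical_mul_e // (negPf yu) scale0r.
  by rewrite (linear_fun0 (sl _)) (linear_fun0 (ml _)) linear_fun0.
have [vr|vr] := eqVneq v r; last first.
  rewrite -radical_mulA h2 h3 radical_mul_e // (negPf vr) scale0r.
  by rewrite (linear_fun0 (sr _)) (linear_fun0 (mr _)) linear_fun0.
subst u r; have xv := lt_trans xy uv; have xt := lt_trans xv rt.
rewrite star_mul_e // !radical_mul_e // eqxx scale1r radical_mul_e // eqxx scale1r.
by rewrite radical_scale_e // (gE x y v t).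
Qed.

End StructureConstants.

Theorem corollary5p13 (d : Order.disp_t) (X : finPOrderType d) (K : fieldType)
  (hX : forall (x y z u v w : X) (xy : (x < y)%O) (yz : (y < z)%O)
               (uv : (u < v)%O) (vw : (v < w)%O),
     chain_equiv (strict2 (lt_trans xy yz)) (strict2 (lt_trans uv vw)) ->
     chain_equiv (strict3 xy yz) (strict3 uv vw))
  (star : subvs_of (radical X K) -> subvs_of (radical X K) ->
          subvs_of (radical X K)) :
  totally_compatible_structure (@radical_mul d X K) star ->
  is_proper (@radical_mul d X K) star.
Proof.
move=> tcs; have c4 := star_coef_chain4 tcs.
pose g := class_value 0 (star_coef star).
apply: (@proper_of_centroid _ _ _ _ (radical_scale g)) => //.
- exact: radical_mul_bilinear.
- exact: radical_mulA.
- exact/radical_scale_centroid/class_value_sub.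
apply: star_mul_centroid => // x y z w xy yz zw.
(* The class of [(x, w)] is evaluated on the triple [(x, y, w)], which lies in the same 4-chain as
   [(x, y, z)]. *)
rewrite /g (class_valueE _ hX c4 xy (lt_trans yz zw)).
by have [] := c4 _ _ _ _ xy yz zw.
Qed.
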